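(* Let $\hat F$ be a regular admissible extended frame on a domain $\Omega\subset\mathbb R^2$ with coefficients $A^i,B^i$, $F=\hat F|_{\lambda=1}$, let $\theta\in\mathbb R$, $\theta\ne0$, and put $\mu=e^{4\theta}$. At every point where $A^2\ne0$ and $B^1\ne0$ — equivalently, where both Hopf differentials $Q^\mu=-A^1A^2(\mu-1)$ and $R^\mu=B^1B^2(\mu^{-1}-1)$ of the immersion $f^\mu=\hat F|_{\lambda=\mu}\hat F|_{\lambda=1}^{-1}$ are nonzero — the map $$g^{2\theta}=\hat F|_{\lambda=e^{4\theta}}\,\exp(2\theta e_3)\,\hat F|_{\lambda=1}^{-1}$$ is a timelike immersion into $\mathbb H^3_1$ of constant mean curvature $$H^{2\theta}=-\coth(2\theta)=-\frac{\mu+1}{\mu-1},$$ with Gauss map $\nu=\mathrm{Ad}_Fe_3$ (the same as that of $f^\mu$), and $$(g^{2\theta})^{-1}g^{2\theta}_x=A^2(\mu-1)\,\mathrm{Ad}_F\xi_2,\qquad (g^{2\theta})^{-1}g^{2\theta}_y=B^1(\mu^{-1}-1)\,\mathrm{Ad}_F\xi_1.$$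
   Context: On the space $\mathfrak{gl}(2,\mathbb R)$ of real $2\times2$ matrices let $\langle X,Y\rangle=-\tfrac12\operatorname{tr}(X\bar Y)$, where $\bar Y=(\operatorname{tr}Y)\mathrm{Id}-Y$; then $\langle X,X\rangle=-\det X$, and anti-de Sitter 3-space is $\mathbb H^3_1=\{\langle X,X\rangle=-1\}=SL(2,\mathbb R)$ with the induced Lorentzian metric. Put $e_3=\begin{pmatrix}-1&0\\0&1\end{pmatrix}$, $\xi_1=\begin{pmatrix}0&0\\1&0\end{pmatrix}$, $\xi_2=\begin{pmatrix}0&1\\0&0\end{pmatrix}$, $\mathrm{Ad}_FX=FXF^{-1}$. All maps are smooth; a domain is a connected open set with coordinates $(x,y)$. An immersion $f$ into $\mathbb H^3_1$ is timelike if the induced metric is Lorentzian. It has Gauss map $\nu$ if $N=f\nu$ is a unit normal ($\langle N,N\rangle=1$, $N$ orthogonal to $f,f_x,f_y$). With the shape operator $S$ defined by $S(f_x,f_y)^T=(N_x,N_y)^T$, the mean curvature is $H=-\tfrac12\operatorname{tr}S$; in null coordinates it equals $\langle f_{xy},N\rangle/\langle f_x,f_y\rangle$. The Hopf differentials in null coordinates are $Q=\langle f_{xx},N\rangle$ and $R=\langle f_{yy},N\rangle$. The immersion $f^\mu$ is taken with unit normal $f^\mu\,\mathrm{Ad}_Fe_3$. An admissible extended frame on $\Omega$ is a family of maps $\hat F|_\lambda:\Omega\to SL(2,\mathbb R)$, depending smoothly on $\lambda\in\mathbb R\setminus\{0\}$ (i.e. a map into the loop group $\Lambda SL(2,\mathbb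 R)$), with $$\hat F^{-1}d\hat F=(\lambda A^1\xi_1+A^2\xi_2+A^3e_3)\,dx+(B^1\xi_1+\lambda^{-1}B^2\xi_2+B^3e_3)\,dy,$$ where $A^i,B^i$ are real functions of $(x,y)$ independent of $\lambda$. It is regular if $A^1\ne0$ and $B^2\ne0$ everywhere on $\Omega$. *)

(* Defs.v *)
From HB Require Import structures.
From mathcomp Require Import all_boot all_order all_algebra.
From mathcomp Require Import all_classical all_reals all_analysis.

Set Implicit Arguments.
Unset Strict Implicit.
Unset Printing Implicit Defensive.

Import Order.TTheory GRing.Theory Num.Theory.
Import numFieldNormedType.Exports.

Local Open Scope classical_set_scope.
Local Open Scope ring_scope.

Section Smoothness.
Context {R : realType}.

(* For finite-dimensional V and open U, having differentials everywhere and
   directional derivatives of class C^k in every direction is being C^(k+1). *)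
Fixpoint class_C (V W : normedModType R) (k : nat) (U : set V) (f : V -> W)
    : Prop :=
  if k is j.+1 then
    (forall p, U p -> differentiable f p) /\
    (forall v : V, class_C j U ('D_v f))
  else forall p, U p -> {for p, continuous f}.

Definition smooth_on (V W : normedModType R) (U : set V) (f : V -> W) : Prop :=
  forall k, class_C k U f.

End Smoothness.

Section Matrices.
Context {R : realType}.

Definition mexp (n : nat) (X : 'M[R]_n.+1) : 'M[R]_n.+1 :=
  lim (series (fun k : nat => (k`!%:R)^-1 *: X ^+ k) @ \oo).

Definition cosh (t : R) : R := (expR t + expR (- t)) / 2.
Definition sinh (t : R) : R := (expR t - expR (- t)) / 2.
Definition coth (t : R) : R := cosh t / sinh t.

Definition bar (Y : 'M[R]_2) : 'M[R]_2 := (\tr Y)%:M - Y.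

Definition ip (X Y : 'M[R]_2) : R := - (1 / 2) * \tr (X *m bar Y).

Definition SL2 : set 'M[R]_2 := [set X | \det X = 1].

Definition H31 : set 'M[R]_2 := [set X | ip X X = -1].

Definition e3 : 'M[R]_2 := delta_mx 1 1 - delta_mx 0 0.
Definition xi1 : 'M[R]_2 := delta_mx 1 0.
Definition xi2 : 'M[R]_2 := delta_mx 0 1.

Definition Ad (F X : 'M[R]_2) : 'M[R]_2 := F *m X *m invmx F.

End Matrices.

Section Surfaces.
Context {R : realType}.

Notation plane := (R * R)%type.

Definition dx (W : normedModType R) (f : plane -> W) : plane -> W :=
  'D_((1, 0) : plane) f.
Definition dy (W : normedModType R) (f : plane -> W) : plane -> W :=
  'D_((0, 1) : plane) f.

Definition domain (U : set plane) : Prop := open U /\ connected U.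

Definition immersion_H31 (U : set plane) (f : plane -> 'M[R]_2) : Prop :=
  [/\ smooth_on U f,
      forall p, U p -> H31 (f p)
    & forall p, U p -> injective ('d f p)].

Definition induced_metric (f : plane -> 'M[R]_2) (p v w : plane) : R :=
  ip ('d f p v) ('d f p w).

(* Signature (1,1) of a symmetric bilinear form on the plane: existence of a
   pseudo-orthonormal (hence linearly independent) pair. *)
Definition lorentzian (b : plane -> plane -> R) : Prop :=
  exists v w, [/\ b v v = 1, b w w = -1 & b v w = 0].

Definition timelike_immersion (U : set plane) (f : plane -> 'M[R]_2) : Prop :=
  immersion_H31 U f /\ forall p, U p -> lorentzian (induced_metric f p).

Definition null_coordinates (U : set plane) (f : plane -> 'M[R]_2) : Prop :=
  forall p, U p -> ip (dx f p) (dx f p) = 0 /\ ip (dy f p) (dy f p) = 0.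

Definition unit_normal (U : set plane) (f N : plane -> 'M[R]_2) : Prop :=
  forall p, U p ->
    [/\ ip (N p) (N p) = 1, ip (N p) (f p) = 0,
        ip (N p) (dx f p) = 0 & ip (N p) (dy f p) = 0].

Definition normal_of (f nu : plane -> 'M[R]_2) : plane -> 'M[R]_2 :=
  fun p => f p *m nu p.

Definition has_gauss_map (U : set plane) (f nu : plane -> 'M[R]_2) : Prop :=
  smooth_on U nu /\ unit_normal U f (normal_of f nu).

(* S is the shape operator at p in the basis (f_x, f_y), with the convention
   S (f_x, f_y)^T = (N_x, N_y)^T; it is unique where f is an immersion. *)
Definition is_shape_operator (f N : plane -> 'M[R]_2) (p : plane)
    (S : 'M[R]_2) : Prop :=
  dx N p = S 0 0 *: dx f p + S 0 1 *: dy f p /\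
  dy N p = S 1 0 *: dx f p + S 1 1 *: dy f p.

Definition has_mean_curvature (f N : plane -> 'M[R]_2) (p : plane) (H : R)
    : Prop :=
  exists2 S, is_shape_operator f N p S & H = - (1 / 2) * \tr S.

(* These are the Hopf differentials when (x, y) are null coordinates. *)
Definition hopfQ (f N : plane -> 'M[R]_2) (p : plane) : R :=
  ip (dx (dx f) p) (N p).
Definition hopfR (f N : plane -> 'M[R]_2) (p : plane) : R :=
  ip (dy (dy f) p) (N p).

(* The loop parameter is the first argument of F; smooth maps into the loop
   group are the maps that are jointly smooth in (x, y) and lambda <> 0. *)
Record admissible_frame (U : set plane) (F : R -> plane -> 'M[R]_2)
    (A1 A2 A3 B1 B2 B3 : plane -> R) : Prop := AdmissibleFrame {
  frame_smooth : smooth_on [set q : plane * R | U q.1 /\ q.2 != 0]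
                   (fun q : plane * R => F q.2 q.1) ;
  frame_SL2 : forall l p, l != 0 -> U p -> SL2 (F l p) ;
  coef_A_smooth : [/\ smooth_on U A1, smooth_on U A2 & smooth_on U A3] ;
  coef_B_smooth : [/\ smooth_on U B1, smooth_on U B2 & smooth_on U B3] ;
  frame_dx : forall l p, l != 0 -> U p ->
    invmx (F l p) *m dx (F l) p
      = (l * A1 p) *: xi1 + A2 p *: xi2 + A3 p *: e3 ;
  frame_dy : forall l p, l != 0 -> U p ->
    invmx (F l p) *m dy (F l) p
      = B1 p *: xi1 + (l^-1 * B2 p) *: xi2 + B3 p *: e3
}.

Definition regular_frame (U : set plane) (A1 B2 : plane -> R) : Prop :=
  forall p, U p -> A1 p != 0 /\ B2 p != 0.

End Surfaces.

(* Main.v *)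
(* For r <> 0 put D_r = diag(r^-1, r) and h_r = F_mu D_r F_1^-1, with normal
   N_r = F_mu D_r e_3 F_1^-1.  As exp (2 theta e_3) = D_r for r = e^(2 theta),
   r = 1 gives f^mu and r^2 = mu gives g^(2 theta).  If dF_l = F_l U_l, then
   d h_r = F_mu (U_mu D_r - D_r U_1) F_1^-1, in which conjugation by D_r scales
   xi_1 by r^-2 and xi_2 by r^2: the e_3 parts cancel, and in each of the two
   cases h_x and h_y are multiples of different ones of the null matrices
   xi_1, xi_2, seen in the frame F_mu D_r, F_1^-1.  The same computation for
   N_r gives the shape operator. *)

Require Import Defs.
From HB Require Import structures.
From mathcomp Require Import all_boot all_order all_algebra.
From mathcomp Require Import all_classical all_reals all_analysis.
From mathcomp Require Import ring.
Import Order.TTheory GRing.Theory Num.Theory.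
Import numFieldNormedType.Exports.
Local Open Scope classical_set_scope.
Local Open Scope ring_scope.

Set Implicit Arguments.
Unset Strict Implicit.
Unset Printing Implicit Defensive.

(** * Calculus of [class_C]: locality, sums, bilinear products, slices *)

Section SmoothMaps.
Context {R : realType}.

(** The first-order expansion of [f] at [p] only sees values near [p], so it is also one of [g];
    uniqueness of the differential then makes ['d f p] the differential of [g]. *)
Lemma near_eq_differentiable (V W : normedModType R) (f g : V -> W) (p : V) :
  (\near p, f p = g p) -> differentiable f p -> differentiable g p.
Proof.
move=> fg df; have fgp := nbhs_singleton fg.
have dgE : g \o shift p = cst (g p) + 'd f p +o_ 0 id.
  apply/eqaddoP => e e0.
  have /eqaddoP/(_ e e0) := diff_locally df.
  have : \forall h \near (0 : V), f (h + p) = g (h + p).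
    by have := fg; rewrite (near_shift 0 p) subr0.
  move=> H1 H2; near=> h.
  have -> : (g \o shift p - (cst (g p) + 'd f p)) h =
      (f \o shift p - (cst (f p) + 'd f p)) h.
    rewrite /GRing.opp /GRing.add /= /GRing.add /= fgp; congr (_ - _).
    by symmetry; near: h.
  by near: h.
have cf := diff_continuous df.
by apply/diff_locallyP; rewrite (diff_unique cf dgE); split.
Unshelve. all: by end_near. Qed.

Lemma derive_eq_on (V W : normedModType R) (U : set V) (f g : V -> W) p v :
  open U -> (forall q, U q -> f q = g q) -> U p -> 'D_v f p = 'D_v g p.
Proof.
move=> oU fg Up; apply: near_eq_derive.
by apply: filterS (open_nbhs_nbhs (conj oU Up)) => q; exact: fg.
Qed.

(** Openness of [U] lets equality on [U] pass to all directional derivatives, which feeds the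
    induction; outside [U] the maps may differ. *)
Lemma class_C_eq (V W : normedModType R) k (U : set V) (f g : V -> W) :
  open U -> (forall p, U p -> f p = g p) -> class_C k U f -> class_C k U g.
Proof.
move=> oU; elim: k f g => [|k IH] f g fg.
  move=> /= fc p Up; have nfg : \near p, f p = g p.
    by apply: filterS (open_nbhs_nbhs (conj oU Up)) => q; exact: fg.
  have := fc p Up; rewrite /prop_for /continuous_at -(fg p Up) => fcp.
  apply: cvg_trans fcp; apply: near_eq_cvg.
  by apply: filterS nfg => q fgq.
have nfg p : U p -> \near p, f p = g p.
  by move=> Up; apply: filterS (open_nbhs_nbhs (conj oU Up)) => q; exact: fg.
move=> [df Cf]; split=> [p Up|v].
  by apply: near_eq_differentiable (nfg p Up) (df p Up).
by apply: IH (Cf v) => p; exact: derive_eq_on.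
Qed.

Lemma class_C_sub (V W : normedModType R) k (U U' : set V) (f : V -> W) :
  U' `<=` U -> class_C k U f -> class_C k U' f.
Proof.
move=> sU; elim: k f => [|k IH] f /=; first by move=> fc p /sU; exact: fc.
by move=> [df Cf]; split=> [p /sU|v]; [exact: df|exact/IH/Cf].
Qed.

Lemma class_C_continuous (V W : normedModType R) k (U : set V) (f : V -> W) p :
  class_C k U f -> U p -> {for p, continuous f}.
Proof.
case: k => [|k] /=; first by move=> fc; exact: fc.
by move=> [df _] Up; apply/differentiable_continuous/df.
Qed.

Lemma class_CW (V W : normedModType R) k (U : set V) (f : V -> W) :
  class_C k.+1 U f -> class_C k U f.
Proof.
elim: k f => [|k IH] f Cf; first by move=> p; exact: class_C_continuous Cf.
by case: Cf => df Cf; split=> // v; exact/IH/Cf.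
Qed.

Lemma class_CD (V W : normedModType R) k (U : set V) (f g : V -> W) :
  open U -> class_C k U f -> class_C k U g -> class_C k U (fun p => f p + g p).
Proof.
move=> oU; elim: k f g => [|k IH] f g.
  by move=> /= fc gc p Up; apply: cvgD; [exact: (fc p Up)|exact: (gc p Up)].
move=> [df Cf] [dg Cg]; split=> [p Up|v].
  by apply: differentiableD; [exact: df|]; exact: dg.
apply: (@class_C_eq _ _ _ _ (fun p => 'D_v f p + 'D_v g p)) => //;
  last by apply: IH; [exact: Cf|exact: Cg].
by move=> p Up; rewrite -deriveD//; apply: diff_derivable; [exact: df|exact: dg].
Qed.

Section Bilinear.
Context (V W1 W2 W : normedModType R) (B : {bilinear W1 -> W2 -> W}).
Context (Bcont : continuous (fun q : W1 * W2 => B q.1 q.2)).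

Lemma is_diff_bilin_comp (f : V -> W1) (g : V -> W2) p :
  differentiable f p -> differentiable g p ->
  is_diff p (fun q => B (f q) (g q))
    (fun h => B (f p) ('d g p h) + B ('d f p h) (g p)).
Proof.
move=> df dg.
have dB : differentiable (fun q : W1 * W2 => B q.1 q.2) (f p, g p).
  exact: differentiable_bilin.
have dfg : differentiable (fun q => (f q, g q)) p by exact: differentiable_pair.
apply: DiffDef; first exact: (differentiable_comp dfg dB).
rewrite (diff_comp dfg dB) diff_bilin// diff_pair//.
Qed.

Lemma derive_bilin_comp (f : V -> W1) (g : V -> W2) p v :
  differentiable f p -> differentiable g p ->
  'D_v (fun q => B (f q) (g q)) p = B (f p) ('D_v g p) + B ('D_v f p) (g p).
Proof.
move=> df dg; have dB := is_diff_bilin_comp df dg.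
by rewrite !deriveE// ?diff_val//; exact: ex_diff.
Qed.

(** By the Leibniz rule a directional derivative is a sum of two values of [B], each with one factor
    differentiated and the other lowered to order [k] by [class_CW], so the induction closes. *)
Lemma class_C_bilin k (U : set V) (f : V -> W1) (g : V -> W2) :
  open U -> class_C k U f -> class_C k U g ->
  class_C k U (fun p => B (f p) (g p)).
Proof.
move=> oU; elim: k f g => [|k IH] f g.
  move=> /= fc gc p Up.
  apply: (@continuous_comp _ _ _ (fun q => (f q, g q)) (fun q => B q.1 q.2)).
    by apply: cvg_pair; [exact: fc|exact: gc].
  exact: Bcont.
move=> Cf Cg; have [df Cdf] := Cf; have [dg Cdg] := Cg; split=> [p Up|v].
  by have := is_diff_bilin_comp (df p Up) (dg p Up) => dB; exact: ex_diff.
apply: (@class_C_eq _ _ _ _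
  (fun p => B (f p) ('D_v g p) + B ('D_v f p) (g p))) => //.
  by move=> p Up; rewrite derive_bilin_comp//; [exact: df|exact: dg].
by apply: class_CD => //; apply: IH;
  [exact: class_CW|exact: Cdg|exact: Cdf|exact: class_CW].
Qed.

End Bilinear.

(** The derivative of a slice along [v] is the slice of the derivative along [(v, 0)]. This extracts
    the smoothness of a frame at fixed loop parameter from joint smoothness. *)
Lemma class_C_slice (V V' W : normedModType R) k (U : set (V * V')) (U' : set V)
    (f : V * V' -> W) l :
  open U' -> (forall p, U' p -> U (p, l)) -> class_C k U f ->
  class_C k U' (fun p => f (p, l)).
Proof.
have dl (p : V) : differentiable (fun q => (q, l)) p.
  by apply: differentiable_pair => //; exact: differentiable_cst.
move=> oU' sU; elim: k f => [|k IH] f.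
  move=> /= fc p /sU Up; apply: (@continuous_comp _ _ _ (fun q => (q, l)) f).
    exact/differentiable_continuous/dl.
  exact: fc.
move=> [df Cf]; split=> [p /sU Up|v].
  by apply: (@differentiable_comp _ _ _ _ (fun q => (q, l)) f) => //; exact: df.
apply: (@class_C_eq _ _ _ _ (fun p => 'D_(v, 0) f (p, l))) => //; last first.
  exact: (IH _ (Cf (v, 0))).
move=> p /sU /df dfp; rewrite !deriveE//;
  last exact: (differentiable_comp (dl p) dfp).
by rewrite (diff_comp (dl p) dfp)/= diff_pair// ?diff_cst//= diff_val.
Qed.

End SmoothMaps.

(** * Limits of matrices, the adjugate, and the determinant form *)

Section Matrices.
Context {R : realType}.
Implicit Types (C X Y F G : 'M[R]_2) (a b l r : R).

(** The matrix norm is the maximum of the finitely many entry norms, so all entries are eventually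
    close at once. *)
Lemma cvg_mx (T : Type) (D : set_system T) (FD : Filter D)
    m n (M : T -> 'M[R]_(m, n)) (L : 'M[R]_(m, n)) :
  (forall i j, M x i j @[x --> D] --> L i j) -> M x @[x --> D] --> L.
Proof.
move=> ML; apply/cvgrPdist_le => /= e e0; near=> x.
rewrite /Num.Def.normr/= mx_normrE (bigmax_le _ (ltW e0))//= => i _.
rewrite !mxE/=; move: i; near: x; apply: filter_forall => /= i.
exact: ((cvgrPdist_le _ _).1 (ML i.1 i.2)).
Unshelve. all: by end_near. Qed.

Lemma cvg_mulmx (T : Type) (D : set_system T) (FD : Filter D) m n p
    (M : T -> 'M[R]_(m, n)) (N : T -> 'M[R]_(n, p))
    (A : 'M[R]_(m, n)) (B : 'M[R]_(n, p)) :
  M x @[x --> D] --> A -> N x @[x --> D] --> B ->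
  M x *m N x @[x --> D] --> A *m B.
Proof.
move=> MA NB; apply: cvg_mx => i j.
rewrite [X in _ --> X]mxE; under eq_fun do rewrite mxE.
apply: cvg_big => [|k _]; first exact: add_continuous.
apply: cvgM.
  exact: (cvg_comp _ _ MA (@coord_continuous _ _ _ i k A)).
exact: (cvg_comp _ _ NB (@coord_continuous _ _ _ k j B)).
Qed.

Lemma sum_ord2 (V : nmodType) (f : 'I_2 -> V) : \sum_i f i = f 0 + f 1.
Proof.
by rewrite big_ord_recl big_ord1; congr (_ + f _); exact: val_inj.
Qed.

Lemma bar_continuous : continuous (@bar R).
Proof.
move=> X; apply: (@cvg_mx _ (nbhs X) (nbhs_filter X)) => i j.
rewrite [X in _ --> X]mxE; under eq_fun do rewrite !mxE.
rewrite !mxE; apply: cvgB; last exact: coord_continuous.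
case: (i == j); rewrite ?mulr0n;
  last by under eq_fun do rewrite mulr0n; exact: cvg_cst.
under eq_fun do rewrite mulr1n /mxtrace sum_ord2.
rewrite mulr1n /mxtrace sum_ord2.
by apply: cvgD; exact: coord_continuous.
Qed.

(* On SL(2) the adjugate [bar Y] is [Y^-1]; being linear in [Y], it makes
   [X C Y^-1] bilinear, hence smooth with the Leibniz rule. *)
Definition sandwich C X Y : 'M[R]_2 := X *m C *m bar Y.

Lemma barD X Y : bar (X + Y) = bar X + bar Y.
Proof. by rewrite /bar mxtraceD raddfD/= opprD addrACA. Qed.

Lemma barZ a X : bar (a *: X) = a *: bar X.
Proof. by rewrite /bar mxtraceZ scalerBr scale_scalar_mx. Qed.

Lemma sandwich_is_bilinear C : bilinear_for
  (GRing.Scale.Law.clone _ _ *:%R _) (GRing.Scale.Law.clone _ _ *:%R _)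
  (sandwich C).
Proof.
split=> [Y|X] a Z T /=; rewrite /sandwich.
  by rewrite !mulmxDl -!scalemxAl /=.
by rewrite barD barZ mulmxDr -scalemxAr.
Qed.

HB.instance Definition _ C := bilinear_isBilinear.Build R
  'M[R]_2 'M[R]_2 'M[R]_2 _ _ (sandwich C) (sandwich_is_bilinear C).

Lemma sandwich_continuous C :
  continuous (fun q : 'M[R]_2 * 'M[R]_2 => sandwich C q.1 q.2).
Proof.
move=> q; apply: cvg_mulmx.
  by apply: cvg_mulmx; [exact: cvg_fst|exact: cvg_cst].
apply: (@continuous_comp _ _ _ snd (@bar R)); first exact: cvg_snd.
exact: bar_continuous.
Qed.

Lemma eq_mx2 X Y : X 0 0 = Y 0 0 -> X 0 1 = Y 0 1 -> X 1 0 = Y 1 0 ->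
  X 1 1 = Y 1 1 -> X = Y.
Proof.
move=> h00 h01 h10 h11; apply/matrixP.
have E (i : 'I_2) : i = 0 \/ i = 1.
  by case: i => -[|[|//]] ?; [left|right]; exact: val_inj.
by move=> i j; case: (E i) => ->; case: (E j) => ->.
Qed.

Lemma det_mx2 X : \det X = X 0 0 * X 1 1 - X 0 1 * X 1 0.
Proof.
rewrite (expand_det_row _ 0) sum_ord2 /cofactor !det_mx11 !mxE /=.
rewrite (_ : lift 0 0 = 1); last exact: val_inj.
rewrite (_ : lift 1 0 = 0); last exact: val_inj.
by rewrite expr0 expr1 mul1r mulN1r mulrN.
Qed.

Definition mx2E := (mxE, sum_ord2, det_mx2).

Lemma bar_mul X Y : bar (X *m Y) = bar Y *m bar X.
Proof. by apply: eq_mx2; rewrite /bar /mxtrace ?mx2E /=; ring. Qed.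

Lemma mulmx_bar X : X *m bar X = (\det X)%:M.
Proof. by apply: eq_mx2; rewrite /bar /mxtrace ?mx2E /=; ring. Qed.

Lemma bar_mulmx X : bar X *m X = (\det X)%:M.
Proof. by apply: eq_mx2; rewrite /bar /mxtrace ?mx2E /=; ring. Qed.

Lemma det_bar X : \det (bar X) = \det X.
Proof. by rewrite /bar /mxtrace ?mx2E /=; ring. Qed.

Lemma invmx_SL2 X : \det X = 1 -> invmx X = bar X.
Proof.
move=> X1; have Xu : X \in unitmx by rewrite unitmxE X1 unitr1.
by rewrite -[LHS]mulmx1 -X1 -mulmx_bar mulKmx.
Qed.

Lemma ip_det X : ip X X = - \det X.
Proof. by rewrite /ip /bar /mxtrace ?mx2E /=; field. Qed.

Lemma H31E X : H31 X <-> \det X = 1.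
Proof. by rewrite /H31/= ip_det; split=> [/oppr_inj//|->]. Qed.

(** Since [bar] reverses products, [G *m bar G] cancels in the middle, and [bar F *m F] cancels
    after a cyclic shift under the trace. *)
Lemma ip_mul F X Y G : \det F = 1 -> \det G = 1 ->
  ip (F *m X *m G) (F *m Y *m G) = ip X Y.
Proof.
move=> F1 G1; rewrite /ip !bar_mul; congr (_ * _).
rewrite mulmxA -[_ *m G *m _]mulmxA mulmx_bar G1 mulmx1 mulmxA mxtrace_mulC.
by rewrite mulmxA mulmxA bar_mulmx F1 mul1mx.
Qed.

End Matrices.

(** * Algebra of the moving frame: boosts, null pairs, polarisation *)

Section FrameAlgebra.
Context {R : realType}.
Implicit Types (C X Y F G : 'M[R]_2) (a b c d r : R).

(** The matrix [D_r]. Using [r] instead of [theta] makes every later identity rational, within reach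
    of [field]. *)
Definition boost r : 'M[R]_2 := r^-1 *: delta_mx 0 0 + r *: delta_mx 1 1.

Lemma boost1 : boost 1 = 1%:M.
Proof. by apply: eq_mx2; rewrite !mx2E /= ?invr1; ring. Qed.

Lemma det_boost r : r != 0 -> \det (boost r) = 1.
Proof. by move=> r0; rewrite !mx2E /=; field. Qed.

(** As [e3] is diagonal with entries -1 and 1, the matrix series splits entrywise into the scalar
    exponential series at [- t] and [t]. *)
Lemma mexp_e3 (t : R) : mexp (t *: e3) = boost (expR t).
Proof.
have pow k : (t *: e3) ^+ k =
    (- t) ^+ k *: delta_mx 0 0 + t ^+ k *: delta_mx 1 1 :> 'M[R]_2.
  elim: k => [|k IH].
    by rewrite !expr0; apply: eq_mx2; rewrite !mx2E /=; ring.
  rewrite exprS IH [in RHS]exprS [t ^+ k.+1]exprS.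
  by rewrite -mulmxE; apply: eq_mx2; rewrite !mx2E /=; ring.
have cvgE (x : R) : series (exp_coeff x) n @[n --> \oo] --> expR x.
  exact: is_cvg_series_exp_coeff.
apply: cvg_lim => //; apply: cvg_mx => i j.
have -> : (fun n => series (fun k : nat => (k`!%:R)^-1 *: (t *: e3) ^+ k) n i j) =
    (fun n => series (exp_coeff (- t)) n * (delta_mx 0 0 : 'M[R]_2) i j +
              series (exp_coeff t) n * (delta_mx 1 1 : 'M[R]_2) i j).
  apply/funext => n; rewrite /series /= summxE !mulr_suml -big_split /=.
  apply: eq_bigr => k _; rewrite pow /exp_coeff /= !mxE.
  by rewrite mulrDr !mulrA [_^-1 * _]mulrC [_^-1 * _]mulrC.
rewrite /boost !mxE -expRN.
by apply: cvgD; (apply: cvgM; [exact: cvgE|exact: cvg_cst]).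
Qed.

Lemma ip_sandwich_boost r X Y F G : r != 0 -> \det F = 1 -> \det G = 1 ->
  ip (sandwich (boost r *m X) F G) (sandwich (boost r *m Y) F G) = ip X Y.
Proof.
move=> r0 F1 G1; rewrite /sandwich !mulmxA ip_mul ?det_bar//.
by rewrite det_mulmx F1 det_boost// mul1r.
Qed.

(** Both [xi1] and [xi2] are null, and their product is 1/2. *)
Lemma ip_xi a b c d : ip (a *: xi1 + b *: xi2) (c *: xi1 + d *: xi2) =
  (a * d + b * c) / 2 :> R.
Proof. by rewrite /ip /bar /mxtrace !mx2E /=; field. Qed.

Lemma ip_e3_xi a b : ip e3 (a *: xi1 + b *: xi2) = 0 :> R.
Proof. by rewrite /ip /bar /mxtrace !mx2E /=; ring. Qed.

Lemma ipC X Y : ip X Y = ip Y X.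
Proof. by rewrite /ip /bar /mxtrace !mx2E /=; ring. Qed.

Lemma ip_scalar a X : ip X a%:M = - (a / 2) * \tr X.
Proof. by rewrite /ip /bar /mxtrace !mx2E /=; field. Qed.

Lemma ip_linl a b X Y Z : ip (a *: X + b *: Y) Z = a * ip X Z + b * ip Y Z.
Proof.
by rewrite /ip mulmxDl -!scalemxAl mxtraceD !mxtraceZ; ring.
Qed.

Lemma ip_lin a b c d X Y : ip (a *: X + b *: Y) (c *: X + d *: Y) =
  a * c * ip X X + (a * d + b * c) * ip X Y + b * d * ip Y Y.
Proof. by rewrite ip_linl ![ip _ (_ + _)]ipC !ip_linl [ip Y X]ipC; ring. Qed.

(** Pairing with [Y] isolates the coefficient of [X], and conversely. *)
Lemma null_pair_free X Y a b c d :
  ip X X = 0 -> ip Y Y = 0 -> ip X Y != 0 ->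
  a *: X + b *: Y = c *: X + d *: Y -> a = c /\ b = d.
Proof.
move=> nX nY nXY E; split; apply: (mulIf nXY).
  by have := congr1 (ip^~ Y) E; rewrite /= !ip_linl nY !mulr0 !addr0.
by have := congr1 (ip^~ X) E; rewrite /= !ip_linl nX [ip Y X]ipC !mulr0 !add0r.
Qed.

(** For null [X] and [Y], the square of [X + s Y] is [2 s] times [ip X Y]; taking [s] to be [t] and
    [- t] normalises it to 1 and -1. *)
Lemma null_pair_orthonormal X Y (t := (2 * ip X Y)^-1) :
  ip X X = 0 -> ip Y Y = 0 -> ip X Y != 0 ->
  [/\ ip (1 *: X + t *: Y) (1 *: X + t *: Y) = 1,
      ip (1 *: X + - t *: Y) (1 *: X + - t *: Y) = -1 &
      ip (1 *: X + t *: Y) (1 *: X + - t *: Y) = 0].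
Proof. by move=> nX nY nXY; rewrite !ip_lin nX nY /t; split; field. Qed.

(** Polarisation of [mulmx_bar]. It expresses [ip] through the bilinear [sandwich], for which the
    Leibniz rule is available. *)
Lemma sandwich_polar X Y :
  sandwich 1%:M X Y + sandwich 1%:M Y X = (- 2 * ip X Y)%:M.
Proof.
by apply: eq_mx2; rewrite /sandwich !mulmx1 /ip /bar /mxtrace !mx2E /=; field.
Qed.

Lemma sandwich_polar2 X Y X' Y' :
  sandwich 1%:M X Y' + sandwich 1%:M X' Y +
    (sandwich 1%:M Y X' + sandwich 1%:M Y' X) = (- 2 * (ip X Y' + ip X' Y))%:M.
Proof. by rewrite mulrDr raddfD/= -!sandwich_polar [X in _ + X]addrC addrACA. Qed.

Lemma det_sandwich C F G : \det C = 1 -> \det F = 1 -> \det G = 1 ->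
  \det (sandwich C F G) = 1.
Proof. by move=> C1 F1 G1; rewrite !det_mulmx det_bar C1 F1 G1 !mulr1. Qed.

(** Combines two tangent vectors along [xi2] and [xi1], in the form that [g_x] and [g_y] take in the
    shape operator equations. *)
Lemma sandwich_xi C F G a b c d :
  a *: sandwich (C *m (0 *: xi1 + c *: xi2)) F G +
    b *: sandwich (C *m (d *: xi1 + 0 *: xi2)) F G =
  sandwich (C *m ((b * d) *: xi1 + (a * c) *: xi2)) F G.
Proof.
rewrite /sandwich !scale0r add0r addr0 (mulmxDr C) (mulmxDr F) mulmxDl addrC.
by rewrite -!scalemxAr -!scalemxAl !scalerA.
Qed.

(** Here [bar G] is the inverse of [G], so it cancels the leading factor of [Ad G X] and leaves [X]
    next to [C]. *)
Lemma sandwich_Ad C X F G : \det G = 1 ->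
  sandwich C F G *m Ad G X = sandwich (C *m X) F G.
Proof.
move=> G1; rewrite /sandwich /Ad invmx_SL2// -!mulmxA; do 2 congr (_ *m _).
by rewrite !mulmxA bar_mulmx G1 mul1mx.
Qed.

End FrameAlgebra.

(** * Derivatives of sandwiches and surfaces with null tangent pairs *)

Section NullSurfaces.
Context {R : realType}.
Notation plane := (R * R)%type.

(** A traceless [W] has [bar W = - W], so [bar G] has derivative [- W *m bar G], as the inverse of
    [G] would. *)
Lemma derive_sandwich (V : normedModType R) C (F G : V -> 'M[R]_2) p v U W :
  differentiable F p -> differentiable G p ->
  'D_v F p = F p *m U -> 'D_v G p = G p *m W -> \tr W = 0 ->
  'D_v (fun q => sandwich C (F q) (G q)) p =
    sandwich (U *m C - C *m W) (F p) (G p).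
Proof.
move=> dF dG DF DG W0.
rewrite derive_bilin_comp//; last exact: sandwich_continuous.
have barW : bar W = - W by rewrite /bar W0 raddf0 sub0r.
rewrite DF DG /= /sandwich bar_mul barW (mulmxBr (F p)) mulmxBl !mulmxA addrC.
by rewrite mulmxN mulNmx.
Qed.

Lemma derive_ip0 (V : normedModType R) (f g : V -> 'M[R]_2) p v :
  differentiable f p -> differentiable g p -> (\near p, ip (f p) (g p) = 0) ->
  ip ('D_v f p) (g p) = - ip (f p) ('D_v g p).
Proof.
move=> df dg fg0.
pose s (x y : V -> 'M[R]_2) := fun q => sandwich 1%:M (x q) (y q).
have ds x y :
    differentiable x p -> differentiable y p -> differentiable (s x y) p.
  move=> dx dy; have := is_diff_bilin_comp (@sandwich_continuous R 1%:M) dx dy.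
  by move=> H; exact: ex_diff.
(* By polarisation this symmetrised sandwich is a scalar matrix proportional to [ip (f q) (g q)],
   hence zero near [p]; its derivative is expanded by Leibniz and read off at one entry. *)
have : 'D_v (fun q => s f g q + s g f q) p = 0.
  rewrite -(derive_cst (0 : 'M[R]_2) p v); apply: near_eq_derive.
  by apply: filterS fg0 => q fgq; rewrite /s sandwich_polar fgq mulr0 raddf0.
rewrite deriveD; try by apply: diff_derivable; exact: ds.
rewrite !derive_bilin_comp//; try exact: sandwich_continuous.
rewrite /= sandwich_polar2 => /matrixP/(_ 0 0); rewrite !mxE /= mulr1n => /eqP.
by rewrite mulf_eq0 oppr_eq0 pnatr_eq0/= addrC addr_eq0 => /eqP.
Qed.

(** Two null partial derivatives with nonzero product are independent, which gives injectivity of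
    the differential, and they span a plane of signature (1,1). *)
Lemma null_timelike (U : set plane) (f : plane -> 'M[R]_2) :
  smooth_on U f -> (forall p, U p -> \det (f p) = 1) ->
  (forall p, U p -> [/\ ip (dx f p) (dx f p) = 0, ip (dy f p) (dy f p) = 0 &
                        ip (dx f p) (dy f p) != 0]) ->
  timelike_immersion U f.
Proof.
move=> sf f1 null.
have dfE p v : U p -> 'd f p v = v.1 *: dx f p + v.2 *: dy f p.
  move=> Up; have [/(_ p Up) df _] := sf 1%N.
  rewrite /dx /dy !deriveE// -!linearZ -linearD; congr ('d f p _).
  case: v => a b; transitivity (a * 1 + b * 0, a * 0 + b * 1) => //.
  by rewrite !mulr0 !mulr1 addr0 add0r.
split; first split => // p Up.
- by apply/H31E/f1.
- move=> [a b] [a' b']; rewrite !dfE//= => E; have [nx ny nxy] := null p Up.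
  by have [-> ->] := null_pair_free nx ny nxy E.
move=> p Up; have [nx ny nxy] := null p Up.
have [e1 e2 e3] := null_pair_orthonormal nx ny nxy.
exists (1, (2 * ip (dx f p) (dy f p))^-1), (1, - (2 * ip (dx f p) (dy f p))^-1).
by rewrite /induced_metric !dfE.
Qed.

End NullSurfaces.

(** * The family of surfaces built from an extended frame *)

Section ExtendedFrames.
Context {R : realType} (Omega : set (R * R)) (F : R -> R * R -> 'M[R]_2).
Context (A1 A2 A3 B1 B2 B3 : R * R -> R).
Context (hOmega : domain Omega).
Context (hF : admissible_frame Omega F A1 A2 A3 B1 B2 B3).

Lemma frame_fiber_smooth l : l != 0 -> smooth_on Omega (F l).
Proof.
move=> l0 k; have oO := hOmega.1.
by apply: (class_C_slice oO _ (frame_smooth hF k)) => p Op; split.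
Qed.

Lemma frame_differentiable l p : l != 0 -> Omega p -> differentiable (F l) p.
Proof. by move=> l0; have [+ _] := frame_fiber_smooth l0 1%N; apply. Qed.

Lemma frame_det l p : l != 0 -> Omega p -> \det (F l p) = 1.
Proof. by move=> l0 Op; exact: (frame_SL2 hF). Qed.

Lemma frame_unit l p : l != 0 -> Omega p -> F l p \in unitmx.
Proof. by move=> l0 Op; rewrite unitmxE frame_det// unitr1. Qed.

Lemma frame_dxE l p : l != 0 -> Omega p -> dx (F l) p =
  F l p *m ((l * A1 p) *: xi1 + A2 p *: xi2 + A3 p *: e3).
Proof.
by move=> l0 Op; rewrite -(frame_dx hF)// mulKVmx// frame_unit.
Qed.

Lemma frame_dyE l p : l != 0 -> Omega p -> dy (F l) p =
  F l p *m (B1 p *: xi1 + (l^-1 * B2 p) *: xi2 + B3 p *: e3).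
Proof.
by move=> l0 Op; rewrite -(frame_dy hF)// mulKVmx// frame_unit.
Qed.

Lemma trace_xi (a b c : R) : \tr (a *: xi1 + b *: xi2 + c *: e3) = 0.
Proof. by rewrite /mxtrace !mx2E /=; ring. Qed.

Lemma dx_sandwich C l m p : l != 0 -> m != 0 -> Omega p ->
  dx (fun q => sandwich C (F l q) (F m q)) p =
  sandwich (((l * A1 p) *: xi1 + A2 p *: xi2 + A3 p *: e3) *m C -
            C *m ((m * A1 p) *: xi1 + A2 p *: xi2 + A3 p *: e3))
    (F l p) (F m p).
Proof.
by move=> l0 m0 Op; apply: derive_sandwich;
  rewrite ?trace_xi//; do ?[exact: frame_differentiable|exact: frame_dxE].
Qed.

Lemma dy_sandwich C l m p : l != 0 -> m != 0 -> Omega p ->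
  dy (fun q => sandwich C (F l q) (F m q)) p =
  sandwich ((B1 p *: xi1 + (l^-1 * B2 p) *: xi2 + B3 p *: e3) *m C -
            C *m (B1 p *: xi1 + (m^-1 * B2 p) *: xi2 + B3 p *: e3))
    (F l p) (F m p).
Proof.
by move=> l0 m0 Op; apply: derive_sandwich;
  rewrite ?trace_xi//; do ?[exact: frame_differentiable|exact: frame_dyE].
Qed.

Context (mu : R) (mu0 : mu != 0).

Let one0 : (1 : R) != 0 := oner_neq0 R.

(* [r = 1] gives f^mu, and [r ^+ 2 = mu] gives g^(2 theta). *)
Definition sym_surface r p := sandwich (boost r) (F mu p) (F 1 p).
Definition sym_normal r p := sandwich (boost r *m e3) (F mu p) (F 1 p).

(** [D_r] is pulled out to the left, leaving its inverse conjugating the form at [mu]. The [xi2]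
    coefficient vanishes for [r = 1], the [xi1] coefficient for [r ^+ 2 = mu]; for the [y]
    derivative the roles are exchanged. *)
Lemma dx_sym_surface r p : r != 0 -> Omega p -> dx (sym_surface r) p =
  sandwich (boost r *m (((mu / r ^+ 2 - 1) * A1 p) *: xi1 +
                        ((r ^+ 2 - 1) * A2 p) *: xi2)) (F mu p) (F 1 p).
Proof.
move=> r0 Op; rewrite dx_sandwich//; congr sandwich.
by apply: eq_mx2; rewrite !mx2E /=; field.
Qed.

Lemma dy_sym_surface r p : r != 0 -> Omega p -> dy (sym_surface r) p =
  sandwich (boost r *m (((r ^- 2 - 1) * B1 p) *: xi1 +
                        ((r ^+ 2 / mu - 1) * B2 p) *: xi2)) (F mu p) (F 1 p).
Proof.
move=> r0 Op; rewrite dy_sandwich//; congr sandwich.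
by apply: eq_mx2; rewrite !mx2E /=; field; rewrite mu0 r0.
Qed.

(** Since [e3] anticommutes with [xi1] and [xi2], the differences in the derivative of the surface
    become sums, up to sign; the [e3] parts still cancel. *)
Lemma dx_sym_normal r p : r != 0 -> Omega p -> dx (sym_normal r) p =
  sandwich (boost r *m ((- (mu / r ^+ 2 + 1) * A1 p) *: xi1 +
                        ((r ^+ 2 + 1) * A2 p) *: xi2)) (F mu p) (F 1 p).
Proof.
move=> r0 Op; rewrite dx_sandwich//; congr sandwich.
by apply: eq_mx2; rewrite !mx2E /=; field.
Qed.

Lemma dy_sym_normal r p : r != 0 -> Omega p -> dy (sym_normal r) p =
  sandwich (boost r *m ((- (r ^- 2 + 1) * B1 p) *: xi1 +
                        ((r ^+ 2 / mu + 1) * B2 p) *: xi2)) (F mu p) (F 1 p).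
Proof.
move=> r0 Op; rewrite dy_sandwich//; congr sandwich.
by apply: eq_mx2; rewrite !mx2E /=; field; rewrite mu0 r0.
Qed.

Lemma sandwich_frame_smooth C l m (U : set (R * R)) :
  open U -> U `<=` Omega -> l != 0 -> m != 0 ->
  smooth_on U (fun p => sandwich C (F l p) (F m p)).
Proof.
move=> oU sU l0 m0 k.
apply: (@class_C_bilin _ _ _ _ _ (sandwich C)) => //;
  first exact: sandwich_continuous.
  by apply: class_C_sub sU _; exact: frame_fiber_smooth.
by apply: class_C_sub sU _; exact: frame_fiber_smooth.
Qed.

Lemma ip_frame r X Y p : r != 0 -> Omega p ->
  ip (sandwich (boost r *m X) (F mu p) (F 1 p))
     (sandwich (boost r *m Y) (F mu p) (F 1 p)) = ip X Y.
Proof. by move=> r0 Op; apply: ip_sandwich_boost => //; exact: frame_det. Qed.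

(** * Geometry of a map that agrees with [sym_surface r] on [Omega] *)

Section SymSurface.
Context (r : R) (r0 : r != 0) (f : R * R -> 'M[R]_2).
Context (fE : forall p, Omega p -> f p = sym_surface r p).

Let nu p := Ad (F 1 p) e3.

Lemma surface_det p : Omega p -> \det (f p) = 1.
Proof.
move=> Op; rewrite fE// det_sandwich ?det_boost//; exact: frame_det.
Qed.

Lemma surface_dx p : Omega p -> dx f p = dx (sym_surface r) p.
Proof. exact: derive_eq_on hOmega.1 fE. Qed.

Lemma surface_dy p : Omega p -> dy f p = dy (sym_surface r) p.
Proof. exact: derive_eq_on hOmega.1 fE. Qed.

Lemma normalE p : Omega p -> normal_of f nu p = sym_normal r p.
Proof.
by move=> Op; rewrite /normal_of fE// sandwich_Ad//; exact: frame_det.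
Qed.

Lemma normal_dx p : Omega p -> dx (normal_of f nu) p = dx (sym_normal r) p.
Proof. exact: derive_eq_on hOmega.1 normalE. Qed.

Lemma normal_dy p : Omega p -> dy (normal_of f nu) p = dy (sym_normal r) p.
Proof. exact: derive_eq_on hOmega.1 normalE. Qed.

Lemma surface_smooth U : open U -> U `<=` Omega -> smooth_on U f.
Proof.
move=> oU sU k; apply: (@class_C_eq _ _ _ _ _ (sym_surface r)) => //.
  by move=> p /sU Op; rewrite fE.
exact: sandwich_frame_smooth.
Qed.

(** In the isometric frame the surface reads as the identity, its normal as [e3], and its tangent
    vectors as combinations of [xi1] and [xi2], all orthogonal to [e3]. *)
Lemma surface_gauss_map U : open U -> U `<=` Omega -> has_gauss_map U f nu.
Proof.
move=> oU sU; split=> [k|p /sU Op].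
  apply: (@class_C_eq _ _ _ _ _ (fun p => sandwich e3 (F 1 p) (F 1 p))) => //.
    by move=> p /sU Op; rewrite /nu /Ad invmx_SL2//; exact: frame_det.
  exact: sandwich_frame_smooth.
rewrite normalE// surface_dx// surface_dy// fE//.
rewrite dx_sym_surface// dy_sym_surface//.
have -> : sym_surface r p = sandwich (boost r *m 1%:M) (F mu p) (F 1 p).
  by rewrite mulmx1.
rewrite !ip_frame// ip_scalar !ip_e3_xi ip_det.
by split=> //; rewrite ?/mxtrace !mx2E /=; ring.
Qed.

(** The square of [a xi1 + b xi2] is [a b]; the hypotheses state that this product vanishes for both
    partial derivatives. *)
Lemma surface_null U : U `<=` Omega ->
  (forall p, U p ->
    (mu / r ^+ 2 - 1) * A1 p * ((r ^+ 2 - 1) * A2 p) = 0 /\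
    (r ^- 2 - 1) * B1 p * ((r ^+ 2 / mu - 1) * B2 p) = 0) ->
  null_coordinates U f.
Proof.
move=> sU null p Up; have Op := sU p Up; have [nx ny] := null p Up.
rewrite surface_dx// surface_dy// dx_sym_surface// dy_sym_surface//.
rewrite !ip_frame// !ip_xi [X in _ + X]mulrC nx.
by rewrite [X in _ /\ (_ + X) / _ = _]mulrC ny addr0 mul0r.
Qed.

(** The expression required to be nonzero is twice [ip (dx f p) (dy f p)]. *)
Lemma surface_timelike U : open U -> U `<=` Omega -> null_coordinates U f ->
  (forall p, U p ->
    (mu / r ^+ 2 - 1) * A1 p * ((r ^+ 2 / mu - 1) * B2 p) +
    (r ^+ 2 - 1) * A2 p * ((r ^- 2 - 1) * B1 p) != 0) ->
  timelike_immersion U f.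
Proof.
move=> oU sU null nz; apply: null_timelike.
- exact: surface_smooth.
- by move=> p /sU; exact: surface_det.
move=> p Up; have Op := sU p Up; have [nx ny] := null p Up; split=> //.
rewrite surface_dx// surface_dy// dx_sym_surface// dy_sym_surface//.
by rewrite ip_frame// ip_xi mulf_neq0// ?nz// invr_eq0 pnatr_eq0.
Qed.

(* Differentiating [<f_v, N> = 0] trades [f_vv] for the first derivative of [N]. *)
Lemma surface_hopf v p (D := 'D_v f) : Omega p ->
  (forall q, Omega q -> ip (D q) (sym_normal r q) = 0) ->
  ip ('D_v D p) (normal_of f nu p) = - ip (D p) ('D_v (sym_normal r) p).
Proof.
move=> Op DN0; rewrite normalE//; have oO := hOmega.1.
have sO : Omega `<=` Omega by [].
apply: derive_ip0.
- have [_ /(_ v) [df _]] := surface_smooth oO sO 2%N; exact: df.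
- have [df _] : class_C 1 Omega (sym_normal r) by exact: sandwich_frame_smooth.
  exact: df.
- by apply: filterS (open_nbhs_nbhs (conj oO Op)) => q; exact: DN0.
Qed.

Lemma surface_hopfQ p : Omega p ->
  hopfQ f (normal_of f nu) p = - ip (dx f p) (dx (sym_normal r) p).
Proof.
move=> Op; apply: surface_hopf => // q Oq.
by rewrite -/(dx f q) surface_dx// dx_sym_surface// ip_frame// ipC ip_e3_xi.
Qed.

Lemma surface_hopfR p : Omega p ->
  hopfR f (normal_of f nu) p = - ip (dy f p) (dy (sym_normal r) p).
Proof.
move=> Op; apply: surface_hopf => // q Oq.
by rewrite -/(dy f q) surface_dy// dy_sym_surface// ip_frame// ipC ip_e3_xi.
Qed.

End SymSurface.

End ExtendedFrames.

(** * Specialisation to [r = 1] and to [r = e^(2 theta)] *)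

Theorem corollary5p13 (R : realType) (Omega : set (R * R))
    (F : R -> R * R -> 'M[R]_2) (A1 A2 A3 B1 B2 B3 : R * R -> R) (theta : R)
    (hOmega : domain Omega)
    (hF : admissible_frame Omega F A1 A2 A3 B1 B2 B3)
    (hreg : regular_frame Omega A1 B2)
    (htheta : theta != 0) :
  let mu : R := expR (4 * theta) in
  let f : R * R -> 'M[R]_2 := fun p => F mu p *m invmx (F 1 p) in
  let g : R * R -> 'M[R]_2 :=
    fun p => F mu p *m mexp ((2 * theta) *: e3) *m invmx (F 1 p) in
  let nu : R * R -> 'M[R]_2 := fun p => Ad (F 1 p) e3 in
  let Q := hopfQ f (normal_of f nu) in
  let R' := hopfR f (normal_of f nu) in
  let Omega' := [set p | [/\ Omega p, A2 p != 0 & B1 p != 0]] in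
  [/\ [/\ timelike_immersion Omega f, has_gauss_map Omega f nu
        & null_coordinates Omega f],
      forall p, Omega p ->
        [/\ Q p = - (A1 p * A2 p * (mu - 1)),
            R' p = B1 p * B2 p * (mu^-1 - 1)
          & (A2 p != 0 /\ B1 p != 0) <-> (Q p != 0 /\ R' p != 0)],
      timelike_immersion Omega' g /\ has_gauss_map Omega' g nu,
      (forall p, Omega' p ->
         has_mean_curvature g (normal_of g nu) p (- coth (2 * theta))) /\
      - coth (2 * theta) = - ((mu + 1) / (mu - 1))
    & forall p, Omega' p ->
        invmx (g p) *m dx g p = (A2 p * (mu - 1)) *: Ad (F 1 p) xi2 /\
        invmx (g p) *m dy g p = (B1 p * (mu^-1 - 1)) *: Ad (F 1 p) xi1].
Proof.
move=> mu f g nu Q R' Omega'.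
have mu0 : mu != 0 by rewrite expR_eq0.
have mu1 : mu - 1 != 0.
  rewrite subr_eq0 -expR0 (inj_eq (@expR_inj R)) mulf_neq0// pnatr_eq0.
have imu1 : mu^-1 - 1 != 0 by rewrite subr_eq0 invr_eq1 -subr_eq0.
pose r := expR (2 * theta); have r0 : r != 0 by rewrite expR_eq0.
have r2 : r ^+ 2 = mu by rewrite -expRM_natl mulrA -natrM.
have one0 : (1 : R) != 0 := oner_neq0 R.
(* Determinant 1 is known only on [Omega], so [f] and [g] are identified with sandwiches only
   there. *)
have invE p : Omega p -> invmx (F 1 p) = bar (F 1 p).
  by move=> Op; rewrite invmx_SL2// (frame_SL2 hF).
have fE p : Omega p -> f p = sym_surface F mu 1 p.
  by move=> Op; rewrite /sym_surface boost1 /sandwich mulmx1 /f invE.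
have gE p : Omega p -> g p = sym_surface F mu r p.
  by move=> Op; rewrite /sym_surface /sandwich /g mexp_e3 invE.
have sO : Omega `<=` Omega by [].
have oO := hOmega.1.
have sO' : Omega' `<=` Omega by move=> p [].
(* Continuity of [A2] and [B1] keeps them nonzero nearby; the smoothness lemmas require an open
   set. *)
have oO' : open Omega'.
  rewrite openE => p; have : Omega' p -> nbhs (p : R * R) Omega'; last exact.
  move=> [Op a b].
  have cA : {for p, continuous A2}.
    by have [_ s _] := coef_A_smooth hF; exact: (s 0%N).
  have cB : {for p, continuous B1}.
    by have [s _ _] := coef_B_smooth hF; exact: (s 0%N).
  have nO := open_nbhs_nbhs (conj oO Op).
  have nA := cvgr_neq0 _ cA a; have nB := cvgr_neq0 _ cB b.
  by apply: filterS3 nO (nA _) (nB _) => q; split.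
have f_null : null_coordinates Omega f.
  apply: (surface_null hOmega hF mu0 one0 fE sO) => p _.
  by rewrite !expr1n invr1; split; ring.
(* Vanishing terms are kept as [0 *: xi1] or [0 *: xi2], the shape that [ip_xi] and [sandwich_xi]
   expect. *)
have f_dx p : Omega p -> dx f p = sandwich (boost 1 *m
    (((mu - 1) * A1 p) *: xi1 + 0 *: xi2)) (F mu p) (F 1 p).
  move=> Op; rewrite (surface_dx hOmega fE)//.
  rewrite (dx_sym_surface hOmega hF mu0 one0)//.
  by rewrite !expr1n divr1 subrr mul0r.
have f_dy p : Omega p -> dy f p = sandwich (boost 1 *m
    (0 *: xi1 + ((mu^-1 - 1) * B2 p) *: xi2)) (F mu p) (F 1 p).
  move=> Op; rewrite (surface_dy hOmega fE)//.
  rewrite (dy_sym_surface hOmega hF mu0 one0)//.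
  by rewrite !expr1n invr1 div1r subrr mul0r.
have g_dx p : Omega p -> dx g p = sandwich (boost r *m
    (0 *: xi1 + ((mu - 1) * A2 p) *: xi2)) (F mu p) (F 1 p).
  move=> Op; rewrite (surface_dx hOmega gE)// (dx_sym_surface hOmega hF mu0 r0)//.
  by rewrite r2 divff// subrr mul0r.
have g_dy p : Omega p -> dy g p = sandwich (boost r *m
    (((mu^-1 - 1) * B1 p) *: xi1 + 0 *: xi2)) (F mu p) (F 1 p).
  move=> Op; rewrite (surface_dy hOmega gE)// (dy_sym_surface hOmega hF mu0 r0)//.
  by rewrite r2 divff// subrr mul0r.
(* Only the [xi1] part of [f_x] survives; it pairs with the [xi2] coefficient [2 * A2 p] of
   [N_x]. *)
have QE p : Omega p -> Q p = - (A1 p * A2 p * (mu - 1)).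
  move=> Op; rewrite /Q (surface_hopfQ hOmega hF mu0 one0 fE)//.
  rewrite f_dx// (dx_sym_normal hOmega hF mu0 one0)//.
  by rewrite (ip_frame hF mu0)// ip_xi expr1n; field.
have RE p : Omega p -> R' p = B1 p * B2 p * (mu^-1 - 1).
  move=> Op; rewrite /R' (surface_hopfR hOmega hF mu0 one0 fE)//.
  rewrite f_dy// (dy_sym_normal hOmega hF mu0 one0)//.
  by rewrite (ip_frame hF mu0)// ip_xi !expr1n invr1; field.
(* Numerator and denominator of [coth] are multiplied by [r]. *)
have HE : - coth (2 * theta) = - ((mu + 1) / (mu - 1)).
  rewrite /coth /cosh /sinh expRN -/r -r2; field.
  by rewrite r2 mu1 r0.
split.
- split=> //; last exact: (surface_gauss_map hOmega hF mu0 one0 fE).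
  (* At [r = 1] only the term in [A1 p * B2 p] remains, nonzero by regularity. *)
  apply: (surface_timelike hOmega hF mu0 one0 fE) => // p Op.
  have [a b] := hreg p Op.
  by rewrite !expr1n subrr !mul0r addr0 divr1 div1r !mulf_neq0.
- move=> p Op; have [a b] := hreg p Op; split; [exact: QE|exact: RE|].
  rewrite QE// RE// oppr_eq0 !mulf_eq0 (negbTE a) (negbTE b).
  by rewrite (negbTE mu1) (negbTE imu1) !orbF.
- split; last exact: (surface_gauss_map hOmega hF mu0 r0 gE).
  (* At [r ^+ 2 = mu] only the term in [A2 p * B1 p] remains, nonzero on [Omega']. *)
  apply: (surface_timelike hOmega hF mu0 r0 gE) => //.
    apply: (surface_null hOmega hF mu0 r0 gE) => // p _.
    by rewrite r2 divff// subrr; split; ring.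
  by move=> p [Op a b]; rewrite r2 divff// subrr !mul0r add0r !mulf_neq0.
- split=> // p [Op a b].
  (* As [g_x] lies along [xi2] and [g_y] along [xi1], each entry is a coefficient of [N_x] or [N_y]
     divided by that of [g_x] or [g_y]. The two diagonal entries agree. *)
  exists (\matrix_(i < 2, j < 2)
    if i == 0 then
      if j == 0 then (mu + 1) / (mu - 1) else - 2 * A1 p / ((mu^-1 - 1) * B1 p)
    else
      if j == 0 then 2 * B2 p / ((mu - 1) * A2 p) else (mu + 1) / (mu - 1)).
    rewrite /is_shape_operator !mxE /=.
    rewrite (normal_dx hOmega hF gE)// (normal_dy hOmega hF gE)//.
    rewrite g_dx// g_dy// (dx_sym_normal hOmega hF mu0 r0)//.
    rewrite (dy_sym_normal hOmega hF mu0 r0)// r2.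
    have mumu : (mu + 1) / (mu - 1) * (mu^-1 - 1) = - (mu^-1 + 1).
      rewrite (_ : mu^-1 - 1 = - (mu - 1) / mu).
        by field; rewrite mu0 mu1.
      by rewrite mulNr mulrBl divff// mul1r opprB.
    (* The four coefficient comparisons; [mu / mu] is what replacing [r ^+ 2] by [mu] leaves in the
       normal's derivatives. *)
    have Sx1 : - 2 * A1 p / ((mu^-1 - 1) * B1 p) * ((mu^-1 - 1) * B1 p) =
        - (mu / mu + 1) * A1 p by rewrite divfK ?mulf_neq0// divff.
    have Sx2 : (mu + 1) / (mu - 1) * ((mu - 1) * A2 p) = (mu + 1) * A2 p.
      by rewrite mulrA divfK.
    have Sy1 : (mu + 1) / (mu - 1) * ((mu^-1 - 1) * B1 p) = - (mu^-1 + 1) * B1 p.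
      by rewrite mulrA mumu.
    have Sy2 : 2 * B2 p / ((mu - 1) * A2 p) * ((mu - 1) * A2 p) =
        (mu / mu + 1) * B2 p by rewrite divfK ?mulf_neq0// divff.
    by rewrite !sandwich_xi Sx1 Sx2 Sy1 Sy2.
  by rewrite HE /mxtrace sum_ord2 !mxE /=; field.
- move=> p [Op a b].
  have gu : g p \in unitmx.
    by rewrite unitmxE (surface_det hF mu0 r0 gE)// unitr1.
  have AdZ c X : c *: Ad (F 1 p) X = Ad (F 1 p) (c *: X).
    by rewrite /Ad -scalemxAr -scalemxAl.
  rewrite g_dx// g_dy// !scale0r add0r addr0.
  (* Read backwards, [sandwich_Ad] splits off [g p] on the left, where [invmx (g p)] cancels it. *)
  rewrite -!sandwich_Ad ?(frame_SL2 hF)//.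
  rewrite -/(sym_surface F mu r p) -gE// !mulKmx//.
  by rewrite !AdZ ![_ * (_ - 1)]mulrC.
Qed.
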